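(* Let $X$ be a biquandle with associated quandle $\mathcal{Q}(X)$, defined by a biquandle structure $\{\alpha_x \mid x\in \mathcal{Q}(X)\}$. Let $Y$ be a medial biquandle with associated quandle $\mathcal{Q}(Y)$, defined by a biquandle structure $\{\beta_y\mid y\in\mathcal{Q}(Y)\}$. Then the associated quandle $\mathcal{Q}(\mathbf{Hom}_B(X,Y))$ of the Hom-biquandle is the subquandle $$\left\{f\in \mathbf{Hom}_Q(\mathcal{Q}(X),\mathcal{Q}(Y)) \;\middle|\; f\circ\alpha_x=\beta_{f(x)}\circ f \text{ for every } x\in\mathcal{Q}(X)\right\}$$ of the Hom-quandle $\mathbf{Hom}_Q(\mathcal{Q}(X),\mathcal{Q}(Y))$. The biquandle structure of $\mathbf{Hom}_B(X,Y)$ is given by $\{\beta_g^{*}\mid g\in \mathrm{Hom}_B(X,Y)\}$, where $(\beta_g^{*}(f))(x)=\beta_{g(x)}(f(x))$ for $f\in \mathrm{Hom}_B(X,Y)$ and $x\in X$.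
   Context: A quandle is a set $Q$ with an operation $*$ such that $x*x=x$; each map $x\mapsto x*y$ is a bijection; and $(x*y)*z=(x*z)*(y*z)$. A quandle homomorphism is a map preserving $*$. A biquandle is a set $X$ with two binary operations $\underline{\ast},\overline{\ast}$ such that: (i) $x\,\underline{\ast}\,x=x\,\overline{\ast}\,x$ for all $x$; (ii) for every $y$ the maps $x\mapsto x\,\underline{\ast}\,y$ and $x\mapsto x\,\overline{\ast}\,y$ are bijections of $X$, and $S(x,y)=(y\,\overline{\ast}\,x,\;x\,\underline{\ast}\,y)$ is a bijection of $X\times X$; (iii) for all $x,y,z$: $(x\underline{\ast}y)\underline{\ast}(z\underline{\ast}y)=(x\underline{\ast}z)\underline{\ast}(y\overline{\ast}z)$, $(x\underline{\ast}y)\overline{\ast}(z\underline{\ast}y)=(x\overline{\ast}z)\underline{\ast}(y\overline{\ast}z)$, $(x\overline{\ast}y)\overline{\ast}(z\overline{\ast}y)=(x\overline{\ast}z)\overline{\ast}(y\underline{\ast}z)$. A biquandle homomorphism is a map preserving both operations; $\mathrm{Hom}_B(X,Y)$ denotes the set of biquandle homomorphisms. The associated quandle $\mathcal{Q}(X)$ of a biquandle $X$ is the set $X$ with operation $x*y=\beta_y^{-1}(x\,\underline{\ast}\,y)$, where $\beta_y(x)=x\,\overline{\ast}\,y$. A biquandle structure on a quandle $(Q,* )$ is a family of quandle automorphisms $\{\beta_y\mid y\in Q\}$ of $Q$ such that (1) $\beta_{\beta_y(x*y)}\circ\beta_y=\beta_{\beta_x(y)}\circ\beta_x$ for all $x,y\in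 Q$, and (2) $y\mapsto\beta_y(y)$ is a bijection of $Q$. It defines a biquandle on the set $Q$ by $x\,\underline{\ast}\,y=\beta_y(x*y)$, $x\,\overline{\ast}\,y=\beta_y(x)$, whose associated quandle is $(Q,* )$; conversely every biquandle $X$ is defined by the biquandle structure $\beta_y(x)=x\,\overline{\ast}\,y$ on $\mathcal{Q}(X)$ (known facts). A biquandle is medial if $(x\underline{\ast}y)\underline{\ast}(z\underline{\ast}w)=(x\underline{\ast}z)\underline{\ast}(y\underline{\ast}w)$, $(x\underline{\ast}y)\overline{\ast}(z\underline{\ast}w)=(x\overline{\ast}z)\underline{\ast}(y\overline{\ast}w)$, $(x\overline{\ast}y)\overline{\ast}(z\overline{\ast}w)=(x\overline{\ast}z)\overline{\ast}(y\overline{\ast}w)$ for all $x,y,z,w$. If $Y$ is medial, $\mathrm{Hom}_B(X,Y)$ with pointwise operations $(f\underline{\ast}g)(x)=f(x)\underline{\ast}g(x)$, $(f\overline{\ast}g)(x)=f(x)\overline{\ast}g(x)$ is a medial biquandle (known), called the Hom-biquandle $\mathbf{Hom}_B(X,Y)$. A quandle is medial if $(x*y)*(z*w)=(x*z)*(y*w)$ for all $x,y,z,w$. For a quandle $Q_1$ and a medial quandle $Q_2$, the set of quandle homomorphisms $Q_1\to Q_2$ with the pointwise operation $(f*g)(x)=f(x)*g(x)$ is a quandle (known), called the Hom-quandle $\mathbf{Hom}_Q(Q_1,Q_2)$. *)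

(* Defs.v *)
From mathcomp Require Import all_boot.
From mathcomp Require Import boolp classical_sets functions.

Set Implicit Arguments.
Unset Strict Implicit.
Unset Printing Implicit Defensive.

Local Open Scope classical_set_scope.

Section BijectiveInverse.
Variables (A B : Type) (f : A -> B).
Hypothesis bij_f : bijective f.

Lemma bij_inv_subproof : exists g : B -> A, cancel f g /\ cancel g f.
Proof. by case: bij_f => g fK gK; exists g. Qed.

Definition bij_inv : B -> A := projT1 (cid bij_inv_subproof).

Lemma bij_invK : cancel f bij_inv.
Proof. by case: (projT2 (cid bij_inv_subproof)). Qed.

Lemma bij_invVK : cancel bij_inv f.
Proof. by case: (projT2 (cid bij_inv_subproof)). Qed.

End BijectiveInverse.

Lemma inj_surj_bij (A B : Type) (f : A -> B) :
  injective f -> (forall b, exists a, f a = b) -> bijective f.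
Proof.
move=> fI fS; pose g b := projT1 (cid (fS b)).
have gK : cancel g f by move=> b; rewrite /g; case: (cid (fS b)).
by exists g => // a; apply: fI; rewrite gK.
Qed.

Declare Scope quandle_scope.
Delimit Scope quandle_scope with quandle.
Local Open Scope quandle_scope.

Record quandle := Quandle {
  quandle_sort :> Type;
  qop : quandle_sort -> quandle_sort -> quandle_sort;
  qopxx : forall x, qop x x = x;
  qop_bij : forall y, bijective (fun x => qop x y);
  qopD : forall x y z, qop (qop x y) z = qop (qop x z) (qop y z)
}.

Notation "x ** y" := (qop x y) (at level 40, left associativity) : quandle_scope.

Definition medial_quandle (Q : quandle) : Prop :=
  forall x y z w : Q, (x ** y) ** (z ** w) = (x ** z) ** (y ** w).

Definition is_quandle_hom (Q1 Q2 : quandle) (f : Q1 -> Q2) : Prop :=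
  forall x y, f (x ** y) = f x ** f y.

Definition is_quandle_aut (Q : quandle) (f : Q -> Q) : Prop :=
  is_quandle_hom f /\ bijective f.

Record quandle_hom (Q1 Q2 : quandle) := QuandleHom {
  qhom_fun :> Q1 -> Q2;
  qhomP : is_quandle_hom qhom_fun
}.

Lemma quandle_hom_ext (Q1 Q2 : quandle) (f g : quandle_hom Q1 Q2) :
  f =1 g -> f = g.
Proof.
case: f g => [f fP] [g gP] /= /funext fg; subst g.
by congr QuandleHom; exact: Prop_irrelevance.
Qed.

(** [A] with the restricted operation is a quandle: idempotence and
    distributivity are inherited, so only closure and the bijectivity of the
    right translations on [A] matter. *)
Definition is_subquandle (Q : quandle) (A : set Q) : Prop :=
  forall b, A b -> set_bij A A (fun a => a ** b).

Section HomQuandle.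
Variables (Q1 Q2 : quandle) (med : medial_quandle Q2).
Implicit Types f g h : quandle_hom Q1 Q2.

Lemma hom_qop_subproof f g : is_quandle_hom (fun x => f x ** g x).
Proof. by move=> x y; rewrite !qhomP med. Qed.

Definition hom_qop f g : quandle_hom Q1 Q2 := QuandleHom (hom_qop_subproof f g).

Lemma hom_qopxx f : hom_qop f f = f.
Proof. by apply: quandle_hom_ext => x /=; rewrite qopxx. Qed.

Lemma hom_qop_bij g : bijective (fun f => hom_qop f g).
Proof.
apply: inj_surj_bij => [f1 f2 e|h].
  apply: quandle_hom_ext => x; apply: (bij_inj (qop_bij (g x))).
  exact: (congr1 (fun h : quandle_hom Q1 Q2 => h x) e).
pose f x := bij_inv (qop_bij (g x)) (h x).
have fE x : f x ** g x = h x by exact: (bij_invVK (qop_bij (g x))).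
have fP : is_quandle_hom f.
  move=> x y; apply: (bij_inj (qop_bij (g (x ** y)))).
  by rewrite fE !qhomP med !fE.
by exists (QuandleHom fP); apply: quandle_hom_ext.
Qed.

Lemma hom_qopD f g h :
  hom_qop (hom_qop f g) h = hom_qop (hom_qop f h) (hom_qop g h).
Proof. by apply: quandle_hom_ext => x; exact: qopD. Qed.

Definition Hom_quandle : quandle := Quandle hom_qopxx hom_qop_bij hom_qopD.

End HomQuandle.

(** [x *_ y] and [x *^ y] are the underlined and the overlined operations. *)
Record biquandle := Biquandle {
  biquandle_sort :> Type;
  under : biquandle_sort -> biquandle_sort -> biquandle_sort;
  over : biquandle_sort -> biquandle_sort -> biquandle_sort;
  underxx : forall x, under x x = over x x;
  under_bij : forall y, bijective (fun x => under x y);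
  over_bij : forall y, bijective (fun x => over x y);
  swap_bij : bijective (fun p : biquandle_sort * biquandle_sort =>
                          (over p.2 p.1, under p.1 p.2));
  exch_uu : forall x y z,
    under (under x y) (under z y) = under (under x z) (over y z);
  exch_uo : forall x y z,
    over (under x y) (under z y) = under (over x z) (over y z);
  exch_oo : forall x y z,
    over (over x y) (over z y) = over (over x z) (under y z)
}.

Notation "x *_ y" := (under x y) (at level 40, left associativity) : quandle_scope.
Notation "x *^ y" := (over x y) (at level 40, left associativity) : quandle_scope.

Definition medial_biquandle (X : biquandle) : Prop :=
  [/\ forall x y z w : X, (x *_ y) *_ (z *_ w) = (x *_ z) *_ (y *_ w),
      forall x y z w : X, (x *_ y) *^ (z *_ w) = (x *^ z) *_ (y *^ w) &
      forall x y z w : X, (x *^ y) *^ (z *^ w) = (x *^ z) *^ (y *^ w)].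

Definition is_biquandle_hom (X Y : biquandle) (f : X -> Y) : Prop :=
  (forall x y, f (x *_ y) = f x *_ f y) /\
  (forall x y, f (x *^ y) = f x *^ f y).

Record biquandle_hom (X Y : biquandle) := BiquandleHom {
  bhom_fun :> X -> Y;
  bhomP : is_biquandle_hom bhom_fun
}.

Lemma biquandle_hom_ext (X Y : biquandle) (f g : biquandle_hom X Y) :
  f =1 g -> f = g.
Proof.
case: f g => [f fP] [g gP] /= /funext fg; subst g.
by congr BiquandleHom; exact: Prop_irrelevance.
Qed.

Lemma bhom_under (X Y : biquandle) (f : biquandle_hom X Y) x y :
  f (x *_ y) = f x *_ f y.
Proof. by case: (bhomP f). Qed.

Lemma bhom_over (X Y : biquandle) (f : biquandle_hom X Y) x y :
  f (x *^ y) = f x *^ f y.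
Proof. by case: (bhomP f). Qed.

Section AssocQuandle.
Variable X : biquandle.
Implicit Types x y z w : X.

Definition assoc_op x y : X := bij_inv (over_bij y) (x *_ y).

Lemma assoc_opE x y : assoc_op x y *^ y = x *_ y.
Proof. exact: (bij_invVK (over_bij y)). Qed.

Lemma over_inj y : injective (fun x => x *^ y).
Proof. exact: bij_inj (over_bij y). Qed.

Lemma assoc_opxx x : assoc_op x x = x.
Proof. by apply: (@over_inj x); rewrite assoc_opE underxx. Qed.

Lemma assoc_op_bij y : bijective (fun x => assoc_op x y).
Proof.
have bij_inv_over : bijective (bij_inv (over_bij y)).
  by exists (fun x => x *^ y); [exact: bij_invVK | exact: bij_invK].
exact: bij_comp bij_inv_over (under_bij y).
Qed.

Lemma over_assoc_op x y z : assoc_op x y *^ z = assoc_op (x *^ z) (y *^ z).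
Proof.
apply: (@over_inj (y *^ z)); rewrite assoc_opE -exch_uo.
by rewrite exch_oo (assoc_opE x y).
Qed.

Lemma under_over x y z :
  (x *^ z) *_ (y *^ z) = (assoc_op x y *^ z) *^ (y *^ z).
Proof. by rewrite -assoc_opE -over_assoc_op. Qed.

Lemma assoc_opD x y z :
  assoc_op (assoc_op x y) z = assoc_op (assoc_op x z) (assoc_op y z).
Proof.
have := exch_uu x z y.
rewrite -(assoc_opE x z) -{1}(assoc_opE y z) under_over assoc_opE.
rewrite -(assoc_opE x y) under_over [RHS]exch_oo => /over_inj/over_inj.
by move=> ->.
Qed.

Definition assoc_quandle : quandle := Quandle assoc_opxx assoc_op_bij assoc_opD.

Lemma assoc_quandle_medial : medial_biquandle X -> medial_quandle assoc_quandle.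
Proof.
move=> [uu uo oo] x y z w /=.
have E a b c d : (a *_ b) *_ (c *_ d) =
    (assoc_op (assoc_op a b) (assoc_op c d) *^ assoc_op c d) *^ (b *_ d).
  rewrite -(assoc_opE a b) -(assoc_opE c d) -uo.
  by rewrite -(assoc_opE (assoc_op a b)).
have := uu x y z w; rewrite !E -(assoc_opE y w) oo (assoc_opE z w).
by move=> /over_inj/over_inj.
Qed.

End AssocQuandle.

Definition is_biquandle_structure (Q : quandle) (beta : Q -> Q -> Q) : Prop :=
  [/\ forall y, is_quandle_aut (beta y),
      forall x y, beta (beta y (x ** y)) \o beta y =1 beta (beta x y) \o beta x &
      bijective (fun y => beta y y)].

(** Both the biquandle defined by [beta] and [X] have the same underlying set,
    so [X] is the biquandle defined by [beta] when the operations agree. *)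
Definition defined_by (X : biquandle)
    (beta : assoc_quandle X -> assoc_quandle X -> assoc_quandle X) : Prop :=
  [/\ is_biquandle_structure beta,
      forall x y : assoc_quandle X, (x : X) *_ y = beta y (x ** y) &
      forall x y : assoc_quandle X, (x : X) *^ y = beta y x].

Arguments defined_by : clear implicits.

Section HomBiquandle.
Variables (X Y : biquandle) (med : medial_biquandle Y).
Implicit Types f g h k : biquandle_hom X Y.

Lemma hom_under_subproof f g : is_biquandle_hom (fun x => f x *_ g x).
Proof.
case: med => uu uo oo; split=> x y.
  by rewrite !bhom_under uu.
by rewrite !bhom_over uo.
Qed.

Lemma hom_over_subproof f g : is_biquandle_hom (fun x => f x *^ g x).
Proof.
case: med => uu uo oo; split=> x y.
  by rewrite !bhom_under uo.
by rewrite !bhom_over oo.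
Qed.

Definition hom_under f g : biquandle_hom X Y :=
  BiquandleHom (hom_under_subproof f g).

Definition hom_over f g : biquandle_hom X Y :=
  BiquandleHom (hom_over_subproof f g).

Lemma hom_underxx f : hom_under f f = hom_over f f.
Proof. by apply: biquandle_hom_ext => x; exact: underxx. Qed.

Lemma hom_under_bij g : bijective (fun f => hom_under f g).
Proof.
case: (med) => uu uo oo.
apply: inj_surj_bij => [f1 f2 e|h].
  apply: biquandle_hom_ext => x; apply: (bij_inj (under_bij (g x))).
  exact: (congr1 (fun h : biquandle_hom X Y => h x) e).
pose f x := bij_inv (under_bij (g x)) (h x).
have fE x : f x *_ g x = h x by exact: (bij_invVK (under_bij (g x))).
have fP : is_biquandle_hom f.
  split=> x y.
    apply: (bij_inj (under_bij (g (x *_ y)))).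
    by rewrite fE !bhom_under uu !fE.
  apply: (bij_inj (under_bij (g (x *^ y)))).
  by rewrite fE !bhom_over -uo !fE.
by exists (BiquandleHom fP); apply: biquandle_hom_ext.
Qed.

Lemma hom_over_bij g : bijective (fun f => hom_over f g).
Proof.
case: (med) => uu uo oo.
apply: inj_surj_bij => [f1 f2 e|h].
  apply: biquandle_hom_ext => x; apply: (@over_inj _ (g x)).
  exact: (congr1 (fun h : biquandle_hom X Y => h x) e).
pose f x := bij_inv (over_bij (g x)) (h x).
have fE x : f x *^ g x = h x by exact: (bij_invVK (over_bij (g x))).
have fP : is_biquandle_hom f.
  split=> x y.
    by apply: (@over_inj _ (g (x *_ y))); rewrite fE !bhom_under uo !fE.
  by apply: (@over_inj _ (g (x *^ y))); rewrite fE !bhom_over oo !fE.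
by exists (BiquandleHom fP); apply: biquandle_hom_ext.
Qed.

Lemma hom_swap_bij :
  bijective (fun p : biquandle_hom X Y * biquandle_hom X Y =>
               (hom_over p.2 p.1, hom_under p.1 p.2)).
Proof.
case: (med) => uu uo oo; have SI := bij_inj (swap_bij Y).
apply: inj_surj_bij => [[f1 g1] [f2 g2] /= [e1 e2]|[h k]].
  have e x : (f1 x, g1 x) = (f2 x, g2 x).
    by apply: SI => /=; rewrite (congr1 (@^~ x) e1) (congr1 (@^~ x) e2).
  by congr pair; apply: biquandle_hom_ext => x; case: (e x).
pose p x := bij_inv (swap_bij Y) (h x, k x).
have pE x : ((p x).2 *^ (p x).1, (p x).1 *_ (p x).2) = (h x, k x).
  exact: (bij_invVK (swap_bij Y)).
have p1 x : (p x).2 *^ (p x).1 = h x by case: (pE x).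
have p2 x : (p x).1 *_ (p x).2 = k x by case: (pE x).
have pu x y : p (x *_ y) = ((p x).1 *_ (p y).1, (p x).2 *_ (p y).2).
  by apply: SI; rewrite pE /= uo uu !p1 !p2 !bhom_under.
have po x y : p (x *^ y) = ((p x).1 *^ (p y).1, (p x).2 *^ (p y).2).
  by apply: SI; rewrite pE /= oo -uo !p1 !p2 !bhom_over.
have fP : is_biquandle_hom (fun x => (p x).1).
  by split=> x y; rewrite ?pu ?po.
have gP : is_biquandle_hom (fun x => (p x).2).
  by split=> x y; rewrite ?pu ?po.
by exists (BiquandleHom fP, BiquandleHom gP); congr pair; apply: biquandle_hom_ext.
Qed.

Lemma hom_exch_uu f g h :
  hom_under (hom_under f g) (hom_under h g) =
  hom_under (hom_under f h) (hom_over g h).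
Proof. by apply: biquandle_hom_ext => x; exact: exch_uu. Qed.

Lemma hom_exch_uo f g h :
  hom_over (hom_under f g) (hom_under h g) =
  hom_under (hom_over f h) (hom_over g h).
Proof. by apply: biquandle_hom_ext => x; exact: exch_uo. Qed.

Lemma hom_exch_oo f g h :
  hom_over (hom_over f g) (hom_over h g) =
  hom_over (hom_over f h) (hom_under g h).
Proof. by apply: biquandle_hom_ext => x; exact: exch_oo. Qed.

Definition Hom_biquandle : biquandle :=
  Biquandle hom_underxx hom_under_bij hom_over_bij hom_swap_bij
    hom_exch_uu hom_exch_uo hom_exch_oo.

End HomBiquandle.

(* Main.v *)
(** Every biquandle is defined by its maps [x |-> x *^ y]; for the Hom-biquandle
    these act pointwise.  Since [x *_ y = (x ** y) *^ y], a map preserves both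
    biquandle operations exactly when it preserves [**] and intertwines the maps
    [x |-> x *^ y], so the associated quandle of the Hom-biquandle embeds onto
    the given subset, which is a subquandle as the image of a homomorphism. *)

Require Import Defs.
From mathcomp Require Import all_boot.
From mathcomp Require Import boolp classical_sets functions.

Local Open Scope classical_set_scope.
Local Open Scope quandle_scope.

Lemma image_subquandle {P Q : quandle} (phi : P -> Q) :
  is_quandle_hom phi -> is_subquandle (range phi).
Proof.
move=> phiM _ [b _ <-]; split.
- by move=> _ [a _ <-] /=; exists (a ** b) => //; exact: phiM.
- by move=> u v _ _; exact: (bij_inj (qop_bij (phi b))).
- move=> _ [c _ <-].
  (* The translation is inverted in [P], not in [Q]: solving [a ** b = c] there keeps the preimage
     [phi a] in the range. *)
  have aE := bij_invVK (qop_bij b) c; set a := bij_inv _ c in aE.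
  by exists (phi a); [exists a | rewrite -phiM aE].
Qed.

Section BiquandleStructure.
Variable X : biquandle.
Implicit Types x y z : X.

(* The two sides act by the same [*^], so [exch_oo] gives [z *^ x = z *^ y] for
   all [z]; hence [(x ** y) *^ y = y *^ y], which forces [x = y]. *)
Lemma swap_diag x y : y *^ x = x *_ y -> x = y.
Proof.
move=> e.
have zE z : z *^ x = z *^ y.
  by apply: (@over_inj X (y *^ x)); rewrite exch_oo -e.
have : assoc_op x y *^ y = y *^ y by rewrite assoc_opE -e zE.
move=> /over_inj; rewrite -{2}(assoc_opxx y).
exact: (bij_inj (assoc_op_bij y)).
Qed.

(** By [underxx], the map of [swap_bij] sends [(x, x)] to [(x *^ x, x *^ x)], so its injectivity
    passes to the diagonal. Its preimage of [(z, z)] lies on the diagonal by [swap_diag], which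
    gives surjectivity. *)
Lemma over_diag_bij : bijective (fun x => x *^ x).
Proof.
apply: inj_surj_bij => [x y e|z].
  have : (x, x) = (y, y).
    by apply: (bij_inj (swap_bij X)) => /=; rewrite !underxx e.
  by case.
have [S' _ S'K] := swap_bij X.
case: (S' (z, z)) (S'K (z, z)) => x y /= [yxE xyE]; exists x.
have exy : x = y by apply: swap_diag; rewrite yxE xyE.
by rewrite -{1}exy in yxE.
Qed.

Lemma defined_by_over : defined_by X (fun y x => x *^ y).
Proof.
split=> [|x y|//]; last by rewrite /= assoc_opE.
split; last exact: over_diag_bij.
- move=> y; split; last exact: over_bij.
  by move=> x z; exact: over_assoc_op.
(* As [(x ** y) *^ y = x *_ y], this condition is the third exchange law. *)
- by move=> x y z /=; rewrite assoc_opE -exch_oo.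
Qed.

End BiquandleStructure.

Lemma bhom_assoc_op {X Y : biquandle} (f : biquandle_hom X Y) (x y : X) :
  f (assoc_op x y) = assoc_op (f x) (f y).
Proof.
by apply: (@over_inj Y (f y)); rewrite -bhom_over !assoc_opE bhom_under.
Qed.

Definition assoc_hom {X Y : biquandle} (f : biquandle_hom X Y) :
    quandle_hom (assoc_quandle X) (assoc_quandle Y) :=
  @QuandleHom (assoc_quandle X) (assoc_quandle Y) f (bhom_assoc_op f).

(** On the left the inverse of [*^ g] is taken among homomorphisms, on the right at each point of
    [Y]. They agree because [*^ g x] is injective and turns both sides into [f x *_ g x]. *)
Lemma hom_assoc_op {X Y : biquandle} {medY : medial_biquandle Y}
    (f g : Hom_biquandle X medY) (x : X) :
  (assoc_op f g : biquandle_hom X Y) x =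
  assoc_op ((f : biquandle_hom X Y) x) ((g : biquandle_hom X Y) x).
Proof.
apply: (@over_inj Y ((g : biquandle_hom X Y) x)); rewrite assoc_opE.
exact: (congr1 (fun h : biquandle_hom X Y => h x) (assoc_opE f g)).
Qed.

Lemma quandle_hom_over_is_biquandle_hom (X Y : biquandle)
    (f : quandle_hom (assoc_quandle X) (assoc_quandle Y)) :
  (forall x y : X, f (x *^ y) = (f x : Y) *^ (f y : Y)) ->
  @is_biquandle_hom X Y f.
Proof.
move=> fo; split=> // x y.
by rewrite -assoc_opE fo -[RHS]assoc_opE; congr (_ *^ _); exact: (qhomP f).
Qed.

Theorem proposition5p4 (X Y : biquandle) (medY : medial_biquandle Y)
    (alpha : assoc_quandle X -> assoc_quandle X -> assoc_quandle X)
    (beta : assoc_quandle Y -> assoc_quandle Y -> assoc_quandle Y)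
    (Xalpha : defined_by X alpha) (Ybeta : defined_by Y beta) :
  let QX := assoc_quandle X in
  let QY := assoc_quandle Y in
  let HomB := Hom_biquandle X medY in
  let HomQ := Hom_quandle QX (assoc_quandle_medial medY) in
  let S : set HomQ :=
    [set f : quandle_hom QX QY | forall x : QX, f \o alpha x = beta (f x) \o f] in
  [/\ is_subquandle S,
      exists phi : assoc_quandle HomB -> HomQ,
        [/\ forall f : biquandle_hom X Y, (phi f : quandle_hom QX QY) =1 f,
            is_quandle_hom phi &
            set_bij setT S phi] &
      exists betaS : assoc_quandle HomB -> assoc_quandle HomB -> assoc_quandle HomB,
        (forall (g f : biquandle_hom X Y) (x : X),
           (betaS g f : biquandle_hom X Y) x = beta (g x) (f x)) /\
        defined_by HomB betaS].
Proof.
move=> QX QY HomB HomQ S.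
have [_ _ alphaE] := Xalpha; have [_ _ betaE] := Ybeta.
pose phi (f : assoc_quandle HomB) : HomQ := assoc_hom f.
have phiM : is_quandle_hom phi.
  by move=> f g; apply: quandle_hom_ext => x; exact: hom_assoc_op.
(* This yields both the closure of [S] and the surjectivity of [phi] onto it. *)
have rangeE : S = range phi.
  apply/seteqP; split=> [f Sf|_ [f _ <-] x].
    have fP : @is_biquandle_hom X Y (f : quandle_hom QX QY).
      apply: quandle_hom_over_is_biquandle_hom => x y.
      (* The intertwining condition for [alpha y], evaluated at [x], is compatibility with [*^]. *)
      rewrite alphaE betaE; exact: (congr1 (@^~ x) (Sf y)).
    by exists (BiquandleHom fP) => //; exact: quandle_hom_ext.
  apply/funext => y /=; rewrite -alphaE -betaE; exact: bhom_over.
split.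
- by rewrite rangeE; exact: image_subquandle.
- exists phi; split=> //; rewrite rangeE; split=> // f g _ _ e.
  apply: biquandle_hom_ext => x.
  exact: (congr1 (fun h : quandle_hom QX QY => h x) e).
(* The canonical structure of [HomB] itself; it is pointwise by construction. *)
- exists (fun g f : HomB => f *^ g); split; last exact: defined_by_over.
  by move=> g f x; rewrite -betaE.
Qed.
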